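(* Let $\mathcal{A}$ be a dual Banach algebra with identity $e$ and predual $\mathcal{A}_*$. The following conditions are equivalent. (i) $\mathcal{A}$ has an approximate normal virtual diagonal. (ii) $\mathcal{A}$ is approximately strongly Connes-amenable.
   Context: Derivations are bounded. For a Banach $\mathcal{A}$-bimodule $\mathcal{X}$, the dual $\mathcal{X}^*$ is a bimodule via $\langle \phi.a,x\rangle=\langle\phi,a.x\rangle$, $\langle a.\phi,x\rangle=\langle\phi,x.a\rangle$. A Banach algebra $\mathcal{A}$ is a dual Banach algebra if there is a closed submodule $\mathcal{A}_*$ of $\mathcal{A}^*$ with $\mathcal{A}=(\mathcal{A}_* )^*$; the predual $\mathcal{A}_*$ is fixed, and $\omega^*$ on $\mathcal{A}$ means $\sigma(\mathcal{A},\mathcal{A}_* )$. A derivation $D:\mathcal{A}\to\mathcal{Y}$ into a Banach bimodule is approximately inner if there is a (not necessarily bounded) net $(y_\alpha)\subseteq\mathcal{Y}$ with $D(a)=\lim_\alpha(a.y_\alpha-y_\alpha.a)$ in norm for every $a\in\mathcal{A}$. An element $\phi\in\mathcal{X}^*$ is normal if the maps $a\mapsto a.\phi$ and $a\mapsto\phi.a$ from $\mathcal{A}$ to $\mathcal{X}^*$ are $\omega^*$-$\omega^*$ continuous. A bimodule $\mathcal{X}$ over the unital algebra $\mathcal{A}$ is unital if $e.x=x.e=x$ for all $x\in\mathcal{X}$. $\mathcal{A}$ is approximately strongly Connes-amenable if for each unital Banach $\mathcal{A}$-bimodule $\mathcal{X}$, every $\omega^*$-$\omega^*$ continuous derivation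 $D:\mathcal{A}\to\mathcal{X}^*$ whose range consists of normal elements is approximately inner. Let $L^2_{\omega^*}(\mathcal{A},\mathbb{C})$ be the Banach space of all bounded bilinear functionals on $\mathcal{A}\times\mathcal{A}$ which are separately $\omega^*$-continuous. It is a Banach $\mathcal{A}$-bimodule via $(a.F)(b,c)=F(b,ca)$, $(F.a)(b,c)=F(ab,c)$, and its dual $L^2_{\omega^*}(\mathcal{A},\mathbb{C})^*$ carries the dual bimodule structure. For $\phi\in\mathcal{A}_*$ the bilinear functional $\Delta^*_{\mathcal{A}}(\phi):(a,b)\mapsto\langle ab,\phi\rangle$ belongs to $L^2_{\omega^*}(\mathcal{A},\mathbb{C})$, and $\Delta_{\omega^*}:L^2_{\omega^*}(\mathcal{A},\mathbb{C})^*\to\mathcal{A}$ is the bimodule homomorphism given by $\langle\Delta_{\omega^*}(M),\phi\rangle=\langle M,\Delta^*_{\mathcal{A}}(\phi)\rangle$ for $\phi\in\mathcal{A}_*$. An approximate normal virtual diagonal for $\mathcal{A}$ is a net $(M_\alpha)$ in $L^2_{\omega^*}(\mathcal{A},\mathbb{C})^*$ such that $a.M_\alpha-M_\alpha.a\to0$ for every $a\in\mathcal{A}$ and $\Delta_{\omega^*}(M_\alpha)\to e$, both limits in norm. *)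

(* Defs.v *)
From HB Require Import structures.
From mathcomp Require Import all_boot all_order all_algebra.
From mathcomp Require Import all_classical all_reals.
From mathcomp Require Import topology normedtype.
From mathcomp Require Import complex.

Set Implicit Arguments.
Unset Strict Implicit.
Unset Printing Implicit Defensive.

Import Order.TTheory GRing.Theory Num.Theory.
Import numFieldNormedType.Exports.

Local Open Scope classical_set_scope.
Local Open Scope complex_scope.
Local Open Scope ring_scope.

(* Scalars are the complex field R[i] over a realType R; R[i]^o is R[i] seen as
   a normed module over itself. *)

Record banach_algebra (R : realType) := BanachAlgebra {
  ba_sort :> completeNormedModType R[i];
  ba_mul : ba_sort -> ba_sort -> ba_sort;
  ba_mulA : forall a b c, ba_mul a (ba_mul b c) = ba_mul (ba_mul a b) c;
  ba_mul_linearl : forall b, linear (ba_mul^~ b);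
  ba_mul_linearr : forall a, linear (ba_mul a);
  ba_normM : forall a b, `|ba_mul a b| <= `|a| * `|b|
}.

Notation "a ** b" := (ba_mul a b) (at level 40, left associativity).

Definition is_identity (R : realType) (A : banach_algebra R) (e : A) :=
  forall a : A, e ** a = a /\ a ** e = a.

Section SupNorm.
Variables (R : realType) (T : Type) (B : set T).
Implicit Types f g : T -> R[i]^o.

Definition supnorm f : R[i] := (sup [set complex.Re `|f t| | t in B])%:C.

Definition bounded_over f := exists M : R, forall t, B t -> `|f t| <= M%:C.

Lemma ReK_norm (V : normedModType R[i]) (x : V) : (complex.Re `|x|)%:C = `|x|.
Proof. by apply/RRe_real/ger0_real. Qed.

Lemma supnorm_ub f t : bounded_over f -> B t -> `|f t| <= supnorm f.
Proof.
move=> [M fM] Bt; rewrite -ReK_norm lecR; apply: ub_le_sup; last by exists t.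
by exists M => _ [u Bu <-]; rewrite -lecR ReK_norm fM.
Qed.

Lemma supnorm_le f (M : R) : B !=set0 -> (forall t, B t -> `|f t| <= M%:C) ->
  supnorm f <= M%:C.
Proof.
move=> [t0 Bt0] fM; rewrite lecR; apply: ge_sup; first by exists (complex.Re `|f t0|), t0.
by move=> _ [t Bt <-]; rewrite -lecR ReK_norm fM.
Qed.

Lemma supnorm_ge0 f : B !=set0 -> bounded_over f -> 0 <= supnorm f.
Proof. by move=> [t Bt] bf; apply: le_trans (supnorm_ub bf Bt). Qed.

Lemma supnormD f g : B !=set0 -> bounded_over f -> bounded_over g ->
  supnorm (f + g) <= supnorm f + supnorm g.
Proof.
move=> B0 bf bg; rewrite -rmorphD; apply: supnorm_le => // t Bt.
rewrite rmorphD /=; apply: le_trans (ler_normD _ _) _.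
by apply: lerD; exact: supnorm_ub.
Qed.

Lemma supnormZ (k : R[i]) f : B !=set0 -> bounded_over f ->
  supnorm (k *: f) = `|k| * supnorm f.
Proof.
move=> B0 bf.
have le k' g : bounded_over g -> supnorm (k' *: g) <= `|k'| * supnorm g.
  move=> bg; have -> : `|k'| = (complex.Re `|k'|)%:C by rewrite (@ReK_norm R[i]^o).
  rewrite -rmorphM; apply: supnorm_le => // t Bt.
  rewrite rmorphM /= (@ReK_norm R[i]^o) normrM.
  by apply: ler_wpM2l => //; exact: supnorm_ub.
have bkf : bounded_over (k *: f).
  case: bf => M fM; exists (complex.Re `|k| * M) => t Bt.
  rewrite rmorphM /= (@ReK_norm R[i]^o) normrM.
  by apply: ler_wpM2l => //; exact: fM.
apply/eqP; rewrite eq_le le //=.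
case: (eqVneq k 0) bkf => [->|k0] bkf.
  by rewrite normr0 mul0r; exact: supnorm_ge0.
rewrite -ler_pdivlMl ?normr_gt0 //.
have {1}-> : f = k^-1 *: (k *: f) by rewrite scalerA mulVf // scale1r.
by apply: le_trans (le _ _ bkf) _; rewrite normfV.
Qed.

Lemma supnorm_eq0 f t : bounded_over f -> supnorm f = 0 -> B t -> f t = 0.
Proof.
by move=> bf f0 Bt; apply/eqP; rewrite -normr_le0 -f0; exact: supnorm_ub.
Qed.

End SupNorm.

Lemma continuousDZ (R : realType) (T : topologicalType) k
    (f g : T -> R[i]^o) :
  continuous f -> continuous g -> continuous (fun x => k *: f x + g x).
Proof.
move=> cf cg x; have := cvgD (cvgZl_tmp (k := k) (cf x)) (cg x); exact.
Qed.

Section Weak.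
Variables (R : realType) (E I : choiceType) (p : E -> I -> R[i]^o).

(* sigma(E, I): the coarsest topology on E making every p^~ i continuous. *)
Definition sigma_top : Type := initial_topology (p : E -> {ptws I -> R[i]^o}).
HB.instance Definition _ := Topological.on sigma_top.

Lemma sigma_pairing_continuous i :
  continuous ((fun x => p x i) : sigma_top -> R[i]^o).
Proof.
move=> x; have px := @initial_continuous E {ptws I -> R[i]^o} p x.
have pi := @proj_continuous I (fun=> R[i]^o) i (p x).
exact: (@continuous_comp sigma_top {ptws I -> R[i]^o} R[i]^o p (proj i) x px pi).
Qed.

Lemma sigma_continuous (T : topologicalType) (f : T -> sigma_top) :
  (forall i, continuous ((fun t => p (f t) i) : T -> R[i]^o)) -> continuous f.
Proof.
move=> cf; apply: continuous_comp_initial => t; apply/cvg_sup => i.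
apply: (@continuous_comp_initial (I -> R[i]^o) T R[i]^o (fun g => g i)).
exact: cf.
Qed.

End Weak.

Section Dual.
Variables (R : realType) (X : normedModType R[i]).

Definition bounded_functional : {pred X -> R[i]^o} := fun f =>
  `[< linear f /\ exists M : R, forall x, `|f x| <= M%:C * `|x| >].

Lemma bounded_functional_submod : submod_closed bounded_functional.
Proof.
split=> [|k f g /asboolP[lf [M fM]] /asboolP[lg [N gN]]]; apply/asboolP.
  split; first by move=> k x y /=; rewrite scaler0 addr0.
  by exists 0 => x; rewrite normr0 mul0r.
split=> [l x y|].
  by rewrite /= !fctE lf lg !scalerDr !scalerA [k * l]mulrC addrACA.
exists (complex.Re `|k| * M + N) => x; rewrite !fctE.
apply: le_trans (ler_normD _ _) _.
rewrite rmorphD rmorphM /= (@ReK_norm R R[i]^o) mulrDl -mulrA normrZ.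
by apply: lerD => //; apply: ler_wpM2l.
Qed.

HB.instance Definition _ := GRing.isSubmodClosed.Build R[i] (X -> R[i]^o)
  bounded_functional bounded_functional_submod.

Record dual := Dual {
  dual_fun :> X -> R[i]^o;
  dual_prop : dual_fun \in bounded_functional }.

HB.instance Definition _ := [isSub for dual_fun].
HB.instance Definition _ := [Choice of dual by <:].
HB.instance Definition _ := [SubChoice_isSubLmodule of dual by <:].

Definition unit_ball : set X := [set x | `|x| <= 1].

Lemma unit_ball_neq0 : unit_ball !=set0.
Proof. by exists 0; rewrite /unit_ball /= normr0. Qed.

Lemma dual_linear (f : dual) : linear f.
Proof. by case: f => f /= /asboolP[]. Qed.

Lemma dual_linE k (f g : dual) x : (k *: f + g) x = k *: f x + g x.
Proof. by []. Qed.

Lemma dual_bounded (f : dual) : exists M : R, forall x, `|f x| <= M%:C * `|x|.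
Proof. by case: f => f /= /asboolP[]. Qed.

Lemma dual_bounded_over (f : dual) : bounded_over unit_ball f.
Proof.
have [M fM] := dual_bounded f; exists `|M| => x x1.
apply: le_trans (fM x) _.
apply: (@le_trans _ _ (`|M|%:C * `|x|)).
  by apply: ler_wpM2r => //; rewrite lecR ler_norm.
by rewrite -[leRHS]mulr1; apply: ler_wpM2l => //; rewrite lecR.
Qed.

Definition dual_norm (f : dual) : R[i] := supnorm unit_ball f.

Lemma dual_normD f g : dual_norm (f + g) <= dual_norm f + dual_norm g.
Proof.
by apply: supnormD; [exact: unit_ball_neq0|exact: dual_bounded_over..].
Qed.

Lemma dual_normZ k f : dual_norm (k *: f) = `|k| * dual_norm f.
Proof. by apply: supnormZ; [exact: unit_ball_neq0|exact: dual_bounded_over]. Qed.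

Lemma dualZ (f : dual) k x : f (k *: x) = k *: f x.
Proof.
have f0 : f 0 = 0.
  apply: (addIr (f 0)).
  by rewrite add0r -{1}[f 0]scale1r -dual_linear scale1r addr0.
by rewrite -[k *: x]addr0 dual_linear f0 addr0.
Qed.

Lemma dual_norm_eq0 f : dual_norm f = 0 -> f = 0.
Proof.
move=> f0; apply/val_inj/funext => x /=.
have [->|x0] := eqVneq x 0; first by rewrite -(scale0r 0) dualZ scale0r.
have : f (`|x|^-1 *: x) = 0.
  apply: supnorm_eq0 (dual_bounded_over f) f0 _.
  by rewrite /unit_ball /= normrZ normfV normr_id mulVf ?normr_eq0.
by rewrite dualZ => /eqP; rewrite scaler_eq0 invr_eq0 normr_eq0 (negPf x0) => /eqP.
Qed.

HB.instance Definition _ := Lmodule_isNormed.Build R[i] dual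
  dual_normD dual_normZ dual_norm_eq0.

Lemma dual_norm_ub (f : dual) x : `|f x| <= `|f| * `|x|.
Proof.
have [->|x0] := eqVneq x 0.
  by rewrite -(scale0r 0) dualZ scale0r normr0 scale0r normr0 mulr0.
rewrite -ler_pdivrMr ?normr_gt0 // mulrC.
have -> : `|x|^-1 * `|f x| = `|f (`|x|^-1 *: x)|.
  by rewrite dualZ normrZ normfV normr_id.
apply: (supnorm_ub (dual_bounded_over f)).
by rewrite /unit_ball /= normrZ normfV normr_id mulVf ?normr_eq0.
Qed.

Lemma dual_norm_le (f : dual) (c : R[i]) : 0 <= c ->
  (forall x, `|f x| <= c * `|x|) -> `|f| <= c.
Proof.
move=> c0 fc; rewrite -(RRe_real (ger0_real c0)).
apply: supnorm_le; first exact: unit_ball_neq0.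
move=> x x1; apply: le_trans (fc x) _; rewrite (RRe_real (ger0_real c0)).
by rewrite -[leRHS]mulr1; exact: ler_wpM2l.
Qed.

End Dual.

Section Bimodule.
Variables (R : realType) (A : banach_algebra R).

(* The actions are bounded, not necessarily contractive. Only a normed space X
   is required; completeness is imposed where Banach bimodules are quantified
   over (duals are always complete). *)
Record bimodule (X : normedModType R[i]) := Bimodule {
  lact : A -> X -> X;
  ract : X -> A -> X;
  lact_linearl : forall x, linear (lact^~ x);
  lact_linearr : forall a, linear (lact a);
  ract_linearl : forall a, linear (ract^~ a);
  ract_linearr : forall x, linear (ract x);
  lactM : forall a b x, lact (a ** b) x = lact a (lact b x);
  ractM : forall x a b, ract x (a ** b) = ract (ract x a) b;
  lract : forall a x b, ract (lact a x) b = lact a (ract x b);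
  lact_bounded : exists M : R, forall a x, `|lact a x| <= M%:C * `|a| * `|x|;
  ract_bounded : exists M : R, forall x a, `|ract x a| <= M%:C * `|x| * `|a|
}.

Definition unital_bimodule (e : A) (X : normedModType R[i]) (B : bimodule X) :=
  forall x, lact B e x = x /\ ract B x e = x.

Definition regular_bimodule : bimodule A.
Proof.
apply: (@Bimodule A (@ba_mul R A) (@ba_mul R A)).
- exact: ba_mul_linearl.
- exact: ba_mul_linearr.
- exact: ba_mul_linearl.
- exact: ba_mul_linearr.
- by move=> a b x; rewrite ba_mulA.
- by move=> x a b; rewrite ba_mulA.
- by move=> a x b; rewrite ba_mulA.
- by exists 1 => a x; rewrite mul1r; exact: ba_normM.
- by exists 1 => x a; rewrite mul1r; exact: ba_normM.
Defined.

Section DualBimodule.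
Variables (X : normedModType R[i]) (B : bimodule X).

Lemma dual_lact_subproof (a : A) (f : dual X) :
  (fun x => f (ract B x a)) \in bounded_functional (X := X).
Proof.
apply/asboolP; split=> [k x y|]; first by rewrite ract_linearl dual_linear.
have [M fM] := dual_bounded f; have [N BN] := ract_bounded B.
exists (`|M| * (`|N| * complex.Re `|a|)) => x; apply: le_trans (fM _) _.
apply: (@le_trans _ _ (`|M|%:C * `|ract B x a|)).
  by apply: ler_wpM2r => //; rewrite lecR ler_norm.
rewrite !rmorphM /= ReK_norm -!mulrA; apply: ler_wpM2l; first by rewrite lecR.
apply: le_trans (BN x a) _; rewrite -mulrA [`|x| * _]mulrC.
by apply: ler_wpM2r; rewrite ?mulr_ge0 // lecR ler_norm.
Qed.

Lemma dual_ract_subproof (f : dual X) (a : A) :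
  (fun x => f (lact B a x)) \in bounded_functional (X := X).
Proof.
apply/asboolP; split=> [k x y|]; first by rewrite lact_linearr dual_linear.
have [M fM] := dual_bounded f; have [N BN] := lact_bounded B.
exists (`|M| * (`|N| * complex.Re `|a|)) => x; apply: le_trans (fM _) _.
apply: (@le_trans _ _ (`|M|%:C * `|lact B a x|)).
  by apply: ler_wpM2r => //; rewrite lecR ler_norm.
rewrite !rmorphM /= ReK_norm -!mulrA; apply: ler_wpM2l; first by rewrite lecR.
apply: le_trans (BN a x) _; rewrite -mulrA.
by apply: ler_wpM2r; rewrite ?mulr_ge0 // lecR ler_norm.
Qed.

(* <a.f, x> = <f, x.a> and <f.a, x> = <f, a.x>. *)
Definition dual_lact a f : dual X := Dual (dual_lact_subproof a f).
Definition dual_ract f a : dual X := Dual (dual_ract_subproof f a).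

Definition dual_bimodule : bimodule (dual X).
Proof.
apply: (@Bimodule (dual X) dual_lact dual_ract).
- move=> f k a b; apply/val_inj/funext => x /=.
  by rewrite ract_linearr dual_linear.
- by move=> a k f g; apply/val_inj/funext.
- by move=> a k f g; apply/val_inj/funext.
- move=> f k a b; apply/val_inj/funext => x /=.
  by rewrite lact_linearl dual_linear.
- by move=> a b f; apply/val_inj/funext => x /=; rewrite ractM.
- by move=> f a b; apply/val_inj/funext => x /=; rewrite lactM.
- by move=> a f b; apply/val_inj/funext => x /=; rewrite lract.
- have [N BN] := ract_bounded B; exists `|N| => a f.
  apply: dual_norm_le => [|x]; first by rewrite !mulr_ge0 // lecR.
  apply: le_trans (dual_norm_ub f _) _; rewrite [leRHS]mulrAC [leRHS]mulrC.
  apply: ler_wpM2l => //; apply: le_trans (BN x a) _.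
  rewrite -!mulrA [`|x| * _]mulrC.
  by apply: ler_wpM2r; rewrite ?mulr_ge0 // lecR ler_norm.
- have [N BN] := lact_bounded B; exists `|N| => f a.
  apply: dual_norm_le => [|x]; first by rewrite !mulr_ge0 // lecR.
  apply: le_trans (dual_norm_ub f _) _.
  rewrite [`|N|%:C * _]mulrC -!mulrA; apply: ler_wpM2l => //.
  apply: le_trans (BN a x) _; rewrite -mulrA.
  by apply: ler_wpM2r; rewrite ?mulr_ge0 // lecR ler_norm.
Defined.

End DualBimodule.

Section ClosedSubmodule.
Variables (X : normedModType R[i]) (B : bimodule X).

Record closed_submodule := ClosedSubmodule {
  csub_set : set X;
  csub0 : csub_set 0;
  csub_linear : forall k x y,
    csub_set x -> csub_set y -> csub_set (k *: x + y);
  csub_lact : forall a x, csub_set x -> csub_set (lact B a x);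
  csub_ract : forall x a, csub_set x -> csub_set (ract B x a);
  csub_closed : closed csub_set
}.

Variable S : closed_submodule.

Definition csub_pred : {pred X} := fun x => `[< csub_set S x >].

Lemma csub_submod : submod_closed csub_pred.
Proof.
split=> [|k x y /asboolP Sx /asboolP Sy]; apply/asboolP; first exact: csub0.
exact: csub_linear.
Qed.

HB.instance Definition _ := GRing.isSubmodClosed.Build R[i] X
  csub_pred csub_submod.

(* S as a normed space in its own right, with the norm of X. *)
Record csub := Csub { csub_val :> X; csub_prop : csub_val \in csub_pred }.

HB.instance Definition _ := [isSub for csub_val].
HB.instance Definition _ := [Choice of csub by <:].
HB.instance Definition _ := [SubChoice_isSubLmodule of csub by <:].

Definition csub_norm (x : csub) : R[i] := `|csub_val x|.

Lemma csub_normD x y : csub_norm (x + y) <= csub_norm x + csub_norm y.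
Proof. exact: ler_normD. Qed.

Lemma csub_normZ k x : csub_norm (k *: x) = `|k| * csub_norm x.
Proof. exact: normrZ. Qed.

Lemma csub_norm_eq0 x : csub_norm x = 0 -> x = 0.
Proof. by move=> /normr0_eq0 x0; exact: val_inj. Qed.

HB.instance Definition _ := Lmodule_isNormed.Build R[i] csub
  csub_normD csub_normZ csub_norm_eq0.

Lemma csub_linE k (x y : csub) :
  csub_val (k *: x + y) = k *: csub_val x + csub_val y.
Proof. by []. Qed.

Lemma csub_mem (x : csub) : csub_set S x.
Proof. by case: x => x /= /asboolP. Qed.

End ClosedSubmodule.

End Bimodule.

Section DualBanachAlgebra.
Variables (R : realType) (A : banach_algebra R).

Local Notation submoduleA :=
  (closed_submodule (dual_bimodule (regular_bimodule A))).

Section Evaluation.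
Variable S : submoduleA.

Lemma pre_eval_subproof (a : A) :
  (fun f : csub S => csub_val f a) \in bounded_functional (X := csub S).
Proof.
apply/asboolP; split=> [k f g|]; first by rewrite csub_linE dual_linE.
exists (complex.Re `|a|) => f; rewrite ReK_norm mulrC.
exact: (dual_norm_ub (csub_val f) a).
Qed.

Definition pre_eval (a : A) : dual (csub S) := Dual (pre_eval_subproof a).

End Evaluation.

(* The predual is kept as data, a closed submodule A_* of A^*; the equality
   A = (A_* )^* is read isometrically: the canonical map from A to (A_* )^* is
   a surjective isometry. *)
Record predual := Predual {
  pre_sub : submoduleA;
  pre_isometry : forall a, `|pre_eval pre_sub a| = `|a|;
  pre_surj : forall f : dual (csub pre_sub), exists a, pre_eval pre_sub a = f
}.

Variable P : predual.

Local Notation A_ := (csub (pre_sub P)).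

Definition wstar : Type := sigma_top (fun (a : A) (phi : A_) => csub_val phi a).
HB.instance Definition _ := Topological.on wstar.

(* The inverse of pre_eval, i.e. the identification (A_* )^* = A. *)
Definition pre_eval_inv (f : dual A_) : A := sval (cid (pre_surj f)).

Lemma pre_eval_invE (f : dual A_) (phi : A_) : csub_val phi (pre_eval_inv f) = f phi.
Proof. by rewrite /pre_eval_inv; case: cid => a /= <-. Qed.

Lemma wstar_continuous_pre (phi : A_) :
  continuous (csub_val phi : wstar -> R[i]^o).
Proof. exact: sigma_pairing_continuous. Qed.

Lemma wstar_continuous_mulr (b : A) :
  continuous ((fun a => a ** b) : wstar -> wstar).
Proof.
apply: sigma_continuous => phi.
have Sphi := csub_lact b (csub_mem phi).
have Sphi' := introT (asboolP _) Sphi.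
exact: (@wstar_continuous_pre (Csub Sphi')).
Qed.

Lemma wstar_continuous_mull (a : A) : continuous (ba_mul a : wstar -> wstar).
Proof.
apply: sigma_continuous => phi.
have Sphi := csub_ract a (csub_mem phi).
have Sphi' := introT (asboolP _) Sphi.
exact: (@wstar_continuous_pre (Csub Sphi')).
Qed.

Definition in_L2 : {pred A -> A -> R[i]^o} := fun F =>
  `[< [/\ forall b, linear (F^~ b), forall a, linear (F a),
         exists M : R, forall a b, `|F a b| <= M%:C * `|a| * `|b|,
         forall b, continuous (F^~ b : wstar -> R[i]^o) &
         forall a, continuous (F a : wstar -> R[i]^o)] >].

Lemma in_L2_submod : submod_closed in_L2.
Proof.
split=> [|k F G /asboolP[lF rF [M FM] cF dF] /asboolP[lG rG [N GN] cG dG]];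
    apply/asboolP.
  split.
  - by move=> b k x y /=; rewrite scaler0 addr0.
  - by move=> a k x y /=; rewrite scaler0 addr0.
  - by exists 0 => a b; rewrite normr0 !mul0r.
  - by move=> b; exact: (@cst_continuous _ _ (0 : R[i]^o)).
  - by move=> a; exact: (@cst_continuous _ _ (0 : R[i]^o)).
split.
- move=> b l x y; rewrite !fctE lF lG !scalerDr !scalerA [k * l]mulrC.
  by rewrite addrACA.
- move=> a l x y; rewrite !fctE rF rG !scalerDr !scalerA [k * l]mulrC.
  by rewrite addrACA.
- exists (complex.Re `|k| * M + N) => a b; rewrite !fctE.
  apply: le_trans (ler_normD _ _) _.
  rewrite rmorphD rmorphM /= (@ReK_norm R R[i]^o) 2!mulrDl -!mulrA normrZ.
  by apply: lerD; rewrite ?mulrA // -!mulrA; apply: ler_wpM2l; rewrite ?mulrA.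
- by move=> b; exact: continuousDZ (cF b) (cG b).
- by move=> a; exact: continuousDZ (dF a) (dG a).
Qed.

HB.instance Definition _ := GRing.isSubmodClosed.Build R[i]
  (A -> A -> R[i]^o) in_L2 in_L2_submod.

(* L^2_{w*}(A, C), normed by the supremum over pairs in the closed unit ball. *)
Record L2 := MkL2 { L2_fun :> A -> A -> R[i]^o; L2_prop : L2_fun \in in_L2 }.

HB.instance Definition _ := [isSub for L2_fun].
HB.instance Definition _ := [Choice of L2 by <:].
HB.instance Definition _ := [SubChoice_isSubLmodule of L2 by <:].

Definition unit_ball2 : set (A * A) := [set p | `|p.1| <= 1 /\ `|p.2| <= 1].

Lemma unit_ball2_neq0 : unit_ball2 !=set0.
Proof. by exists (0, 0); rewrite /unit_ball2 /= normr0. Qed.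

Lemma L2P (F : L2) : [/\ forall b, linear (F^~ b), forall a, linear (F a),
  exists M : R, forall a b, `|F a b| <= M%:C * `|a| * `|b|,
  forall b, continuous (F^~ b : wstar -> R[i]^o) &
  forall a, continuous (F a : wstar -> R[i]^o)].
Proof. by case: F => F /= /asboolP. Qed.

Lemma L2_linE k (F G : L2) a b : (k *: F + G) a b = k *: F a b + G a b.
Proof. by []. Qed.

Definition L2_uncurry (F : L2) : A * A -> R[i]^o := fun p => F p.1 p.2.

Lemma L2_bounded_over (F : L2) : bounded_over unit_ball2 (L2_uncurry F).
Proof.
have [_ _ [M FM] _ _] := L2P F; exists `|M| => -[a b] [/= a1 b1].
apply: le_trans (FM a b) _; rewrite -mulrA.
apply: (@le_trans _ _ (`|M|%:C * (`|a| * `|b|))).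
  by apply: ler_wpM2r; rewrite ?mulr_ge0 // lecR ler_norm.
by rewrite -[leRHS]mulr1; apply: ler_wpM2l; rewrite ?lecR ?mulr_ile1.
Qed.

Definition L2_norm (F : L2) : R[i] := supnorm unit_ball2 (L2_uncurry F).

Lemma L2_addE (F G : L2) a b : (F + G) a b = F a b + G a b.
Proof. by []. Qed.

Lemma L2_scaleE k (F : L2) a b : (k *: F) a b = k *: F a b.
Proof. by []. Qed.

Lemma L2_normD F G : L2_norm (F + G) <= L2_norm F + L2_norm G.
Proof.
rewrite /L2_norm.
have -> : L2_uncurry (F + G) = L2_uncurry F + L2_uncurry G.
  by apply/funext => p; rewrite /L2_uncurry L2_addE.
exact: supnormD unit_ball2_neq0 (L2_bounded_over F) (L2_bounded_over G).
Qed.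

Lemma L2_normZ k F : L2_norm (k *: F) = `|k| * L2_norm F.
Proof.
rewrite /L2_norm; have -> : L2_uncurry (k *: F) = k *: L2_uncurry F.
  by apply/funext => p; rewrite /L2_uncurry L2_scaleE.
exact: supnormZ unit_ball2_neq0 (L2_bounded_over F).
Qed.

Lemma L2Zl (F : L2) k a b : F (k *: a) b = k *: F a b.
Proof.
have [lF _ _ _ _] := L2P F.
have F0 : F 0 b = 0.
  by apply: (addIr (F 0 b)); rewrite add0r -{1}[F 0 b]scale1r -lF scale1r addr0.
by rewrite -[k *: a]addr0 lF F0 addr0.
Qed.

Lemma L2Zr (F : L2) k a b : F a (k *: b) = k *: F a b.
Proof.
have [_ rF _ _ _] := L2P F.
have F0 : F a 0 = 0.
  by apply: (addIr (F a 0)); rewrite add0r -{1}[F a 0]scale1r -rF scale1r addr0.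
by rewrite -[k *: b]addr0 rF F0 addr0.
Qed.

Lemma norm_normalize (V : normedModType R[i]) (x : V) :
  x != 0 -> `| `|x|^-1 *: x| <= 1.
Proof. by move=> x0; rewrite normrZ normfV normr_id mulVf ?normr_eq0. Qed.

Lemma L2_norm_ge0 (F : L2) : 0 <= L2_norm F.
Proof. exact: supnorm_ge0 unit_ball2_neq0 (L2_bounded_over F). Qed.

#[local] Hint Resolve L2_norm_ge0 : core.

Lemma L2_norm_ub (F : L2) a b : `|F a b| <= L2_norm F * `|a| * `|b|.
Proof.
have [->|a0] := eqVneq a 0.
  by rewrite -[X in F X _](scale0r 0) L2Zl scale0r normr0 !mulr_ge0.
have [->|b0] := eqVneq b 0.
  by rewrite -[X in F _ X](scale0r 0) L2Zr scale0r normr0 !mulr_ge0.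
rewrite -!ler_pdivrMr ?normr_gt0 //.
have -> : `|F a b| / `|b| / `|a| = `|F (`|a|^-1 *: a) (`|b|^-1 *: b)|.
  by rewrite L2Zl L2Zr !normrZ !normfV !normr_id mulrC [_ / `|b|]mulrC.
apply: (@supnorm_ub _ _ unit_ball2 (L2_uncurry F)
          (`|a|^-1 *: a, `|b|^-1 *: b)); first exact: L2_bounded_over.
by split; exact: norm_normalize.
Qed.

Lemma L2_norm_le (F : L2) (c : R[i]) : 0 <= c ->
  (forall a b, `|F a b| <= c * `|a| * `|b|) -> L2_norm F <= c.
Proof.
move=> c0 Fc; rewrite -(RRe_real (ger0_real c0)).
apply: supnorm_le; first exact: unit_ball2_neq0.
move=> [a b] [/= a1 b1]; rewrite (RRe_real (ger0_real c0)).
apply: le_trans (Fc a b) _; rewrite -mulrA -[leRHS]mulr1.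
by apply: ler_wpM2l; rewrite ?mulr_ile1.
Qed.

Lemma L2_norm_eq0 F : L2_norm F = 0 -> F = 0.
Proof.
move=> F0; apply/val_inj/funext => a; apply/funext => b.
apply/eqP; rewrite -normr_le0; apply: le_trans (L2_norm_ub F a b) _.
by rewrite F0 !mul0r.
Qed.

HB.instance Definition _ := Lmodule_isNormed.Build R[i] L2
  L2_normD L2_normZ L2_norm_eq0.

Lemma L2_lact_subproof (a : A) (F : L2) :
  (fun b c => F b (c ** a)) \in in_L2.
Proof.
have [lF rF _ cF dF] := L2P F; apply/asboolP; split.
- by move=> c k x y; rewrite lF.
- by move=> b k x y; rewrite ba_mul_linearl rF.
- exists (complex.Re `|F| * complex.Re `|a|) => b c.
  rewrite rmorphM /= !ReK_norm; apply: le_trans (L2_norm_ub F _ _) _.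
  rewrite -!mulrA; apply: ler_wpM2l => //.
  by rewrite mulrCA; apply: ler_wpM2l => //; rewrite mulrC ba_normM.
- by move=> c; exact: cF.
- move=> b x.
  exact: (continuous_comp (@wstar_continuous_mulr a x) (dF b (x ** a))).
Qed.

Lemma L2_ract_subproof (F : L2) (a : A) :
  (fun b c => F (a ** b) c) \in in_L2.
Proof.
have [lF rF _ cF dF] := L2P F; apply/asboolP; split.
- by move=> c k x y; rewrite ba_mul_linearr lF.
- by move=> b k x y; rewrite rF.
- exists (complex.Re `|F| * complex.Re `|a|) => b c.
  rewrite rmorphM /= !ReK_norm; apply: le_trans (L2_norm_ub F _ _) _.
  rewrite -!mulrA; apply: ler_wpM2l => //.
  by rewrite mulrA; apply: ler_wpM2r => //; exact: ba_normM.
- move=> c x.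
  exact: (continuous_comp (@wstar_continuous_mull a x) (cF c (a ** x))).
- by move=> b; exact: dF.
Qed.

(* (a.F)(b, c) = F(b, ca) and (F.a)(b, c) = F(ab, c). *)
Definition L2_lact a F : L2 := MkL2 (L2_lact_subproof a F).
Definition L2_ract F a : L2 := MkL2 (L2_ract_subproof F a).

Definition L2_bimodule : bimodule A L2.
Proof.
apply: (@Bimodule R A L2 L2_lact L2_ract).
- move=> F k a b; apply/val_inj/funext => x; apply/funext => y.
  by have [_ rF _ _ _] := L2P F; rewrite /= ba_mul_linearr rF.
- by move=> a k F G; apply/val_inj/funext => x; apply/funext.
- by move=> a k F G; apply/val_inj/funext => x; apply/funext.
- move=> F k a b; apply/val_inj/funext => x; apply/funext => y.
  by have [lF _ _ _ _] := L2P F; rewrite /= ba_mul_linearl lF.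
- by move=> a b F; apply/val_inj/funext => x; apply/funext => y /=;
  rewrite ba_mulA.
- by move=> F a b; apply/val_inj/funext => x; apply/funext => y /=;
  rewrite ba_mulA.
- by move=> a F b; apply/val_inj.
- exists 1 => a F; rewrite mul1r mulrC.
  apply: L2_norm_le => [|x y]; first by rewrite mulr_ge0.
  apply: le_trans (L2_norm_ub F _ _) _; rewrite -!mulrA; apply: ler_wpM2l => //.
  by rewrite mulrCA; apply: ler_wpM2l => //; rewrite mulrC ba_normM.
- exists 1 => F a; rewrite mul1r.
  apply: L2_norm_le => [|x y]; first by rewrite mulr_ge0.
  apply: le_trans (L2_norm_ub F _ _) _; rewrite -!mulrA; apply: ler_wpM2l => //.
  by rewrite mulrA; apply: ler_wpM2r => //; exact: ba_normM.
Defined.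

Lemma Delta_pre_subproof (phi : A_) :
  (fun a b => csub_val phi (a ** b)) \in in_L2.
Proof.
apply/asboolP; split.
- by move=> b k x y; rewrite ba_mul_linearl dual_linear.
- by move=> a k x y; rewrite ba_mul_linearr dual_linear.
- exists (complex.Re `|csub_val phi|) => a b; rewrite ReK_norm -mulrA.
  apply: le_trans (dual_norm_ub _ _) _.
  by apply: ler_wpM2l => //; exact: ba_normM.
- move=> b x; exact: (continuous_comp (@wstar_continuous_mulr b x)
                        (@wstar_continuous_pre phi (x ** b))).
- move=> a x; exact: (continuous_comp (@wstar_continuous_mull a x)
                        (@wstar_continuous_pre phi (a ** x))).
Qed.

(* Delta^*_A : A_* -> L2 *)
Definition Delta_pre (phi : A_) : L2 := MkL2 (Delta_pre_subproof phi).

Lemma Delta_subproof (M : dual L2) :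
  (fun phi => M (Delta_pre phi)) \in bounded_functional (X := A_).
Proof.
apply/asboolP; split=> [k f g|].
  rewrite -dual_linear; congr (M _); apply/val_inj/funext => a.
  apply/funext => b; change (csub_val (k *: f + g) (a ** b) =
    k *: csub_val f (a ** b) + csub_val g (a ** b)).
  by rewrite csub_linE dual_linE.
exists (complex.Re `|M|) => phi; rewrite ReK_norm.
apply: le_trans (dual_norm_ub M _) _; apply: ler_wpM2l => //.
apply: L2_norm_le => // a b; rewrite -mulrA.
apply: le_trans (dual_norm_ub (csub_val phi) _) _.
by apply: ler_wpM2l => //; exact: ba_normM.
Qed.

(* Delta_{w*} : L2^* -> A, through (A_* )^* = A *)
Definition Delta (M : dual L2) : A := pre_eval_inv (Dual (Delta_subproof M)).

Lemma DeltaE (M : dual L2) (phi : A_) :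
  csub_val phi (Delta M) = M (Delta_pre phi).
Proof. by rewrite pre_eval_invE. Qed.

End DualBanachAlgebra.

Record directed_set := DirectedSet {
  dir_sort :> Type;
  dir_le : dir_sort -> dir_sort -> Prop;
  dir_refl : forall i, dir_le i i;
  dir_trans : forall i j k, dir_le i j -> dir_le j k -> dir_le i k;
  dir_ub : forall i j, exists k, dir_le i k /\ dir_le j k;
  dir_inhabited : inhabited dir_sort
}.

(* Limits of a net indexed by I are limits along this filter. *)
Definition tails (I : directed_set) : set_system I :=
  [set S | exists i, forall j, dir_le i j -> S j].
Arguments tails : clear implicits.

Instance tails_filter (I : directed_set) : ProperFilter (tails I).
Proof.
split; first by move=> [i /(_ i (dir_refl i))].
split.
- by have [i0] := dir_inhabited I; exists i0.
- move=> S T [i Si] [j Tj]; have [k [ik jk]] := dir_ub i j.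
  by exists k => l kl; split; [apply: Si|apply: Tj]; exact: dir_trans kl.
- by move=> S T ST [i Si]; exists i => j /Si /ST.
Qed.

Section Amenability.
Variables (R : realType) (A : banach_algebra R).

Definition is_derivation (Y : normedModType R[i]) (B : bimodule A Y)
    (D : A -> Y) :=
  [/\ linear D,
      exists M : R, forall a, `|D a| <= M%:C * `|a| &
      forall a b, D (a ** b) = lact B a (D b) + ract B (D a) b].

Definition approximately_inner (Y : normedModType R[i]) (B : bimodule A Y)
    (D : A -> Y) :=
  exists (I : directed_set) (y : I -> Y), forall a,
    lact B a (y i) - ract B (y i) a @[i --> tails I] --> D a.

Definition dual_wstar (X : normedModType R[i]) : Type :=
  sigma_top (fun (f : dual X) (x : X) => f x).
HB.instance Definition _ (X : normedModType R[i]) :=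
  Topological.on (dual_wstar X).

Variable P : predual A.

Definition normal_elt (X : normedModType R[i]) (B : bimodule A X)
    (phi : dual X) :=
  continuous ((fun a => lact (dual_bimodule B) a phi) : wstar P -> dual_wstar X)
  /\
  continuous ((fun a => ract (dual_bimodule B) phi a) : wstar P -> dual_wstar X).

Definition approx_strongly_Connes_amenable (e : A) :=
  forall (X : completeNormedModType R[i]) (B : bimodule A X),
    unital_bimodule e B ->
  forall D : A -> dual X, is_derivation (dual_bimodule B) D ->
    continuous (D : wstar P -> dual_wstar X) ->
    (forall a, normal_elt B (D a)) ->
    approximately_inner (dual_bimodule B) D.

Definition has_approx_normal_virtual_diagonal (e : A) :=
  exists (I : directed_set) (M : I -> dual (L2 P)),
    (forall a, lact (dual_bimodule (L2_bimodule P)) a (M i)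
               - ract (dual_bimodule (L2_bimodule P)) (M i) a
                 @[i --> tails I] --> (0 : dual (L2 P)))
    /\ Delta (M i) @[i --> tails I] --> e.

End Amenability.

(* Main.v *)
Require Import Defs.
From HB Require Import structures.
From mathcomp Require Import all_boot all_order all_algebra.
From mathcomp Require Import all_classical all_reals.
From mathcomp Require Import topology normedtype.
From mathcomp Require Import complex.

(** The proof compares two ways of moving between virtual diagonals and the
    elements that implement a derivation.

    From a diagonal to amenability. Let [D] be a weak-star continuous derivation
    into [X^*] with normal values. Each [x] gives a bilinear functional
    [F_x(a, b) = <a.D(b), x>], which is separately weak-star continuous: in [a]
    because [D b] is normal, in [b] because [D] is continuous. For [M] in the
    dual of [L2] put [phi(x) = M(F_x)]. The derivation rule yields
    ([transport_commutator])
      [a.phi - phi.a = (a.M - M.a)(F_(-)) + Delta(M).D(a)],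
    where the last term appears because [b |-> <b.D(a), x>] belongs to the
    predual. Along an approximate diagonal the first summand tends to 0 and the
    second to [e.D(a) = D(a)]. Membership in the predual is the classical fact
    that a functional continuous for a weak topology is a finite linear
    combination of the functionals that define it ([sigma_continuous_mem]).

    From amenability to a diagonal. The functional [u(F) = F(e, e)] satisfies
    [Delta(u) = e], and its inner derivation takes values in the kernel of
    [Delta]. This kernel is the dual of the quotient of [L2] by the range of
    [Delta_pre]. Since [A] has an identity, the range is complemented by
    [{F | F(., e) = 0}], through the projection
    [F |-> ((b, c) |-> F(b, c) - F(bc, e))]; the quotient is therefore replaced
    by this closed subspace with the left action transported to it,
    [(a.F)(b, c) = F(b, ca) - F(bc, a)]. It is a unital Banach bimodule
    ([L2_cauchy_cvg] gives completeness), and the inner derivation of [u] is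
    weak-star continuous with normal values there. If [y_i] approximately
    implements it, then [u] minus the pullback of [y_i] along the projection is
    an approximate diagonal: the commutators tend to 0, and [Delta] is still [e]
    because the projection kills the range of [Delta_pre]. *)

Set Implicit Arguments.
Unset Strict Implicit.
Unset Printing Implicit Defensive.

Import Order.TTheory GRing.Theory Num.Theory.
Import numFieldNormedType.Exports.

Local Open Scope classical_set_scope.
Local Open Scope complex_scope.
Local Open Scope ring_scope.

(** * Completeness and Cauchy filters *)

Section Completeness.
Variable R : realType.

Lemma norm_complex_le (z : R[i]) :
  `|z| <= `|complex.Re z|%:C + `|complex.Im z|%:C.
Proof.
rewrite {1}[z]complexE; apply: le_trans (ler_normD _ _) _.
rewrite normrM !normc_def /= !expr0n expr1n add0r sqrtr1 mul1r !addr0.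
by rewrite !sqrtr_sqr.
Qed.

(** Completeness of the scalars, in a form that applies to any family indexed
    by a filtered set: the real and imaginary parts converge separately. *)
Lemma complex_cauchy_lim (T : Type) (F : set_system T) (h : T -> R[i]^o) :
  ProperFilter F ->
  (forall e : R, 0 < e ->
     exists2 U, F U & forall x y, U x -> U y -> `|h x - h y| < e%:C) ->
  exists z : R[i]^o, h @ F --> z.
Proof.
move=> FF hF.
have part_lim (part : R[i] -> R) :
    (forall z w, part (z - w) = part z - part w) ->
    (forall z, `|part z|%:C <= `|z|) ->
      exists r : R^o, (fun t => part (h t) : R^o) @ F --> r.
  move=> partB part_le; apply/cvg_ex; apply: cauchy_cvg.
  apply: cauchy_exP => e e0.
  have [U FU Ue] := hF e e0; have [x Ux] := filter_ex FU.
  exists (part (h x)).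
  suff: F [set t | `|part (h x) - part (h t)| < e] by [].
  apply: filterS FU => y Uy /=; rewrite -partB -ltcR.
  exact: le_lt_trans (part_le _) (Ue _ _ Ux Uy).
have [r hr] : exists r : R^o, (fun t => complex.Re (h t) : R^o) @ F --> r.
  by apply: part_lim => [[? ?] [? ?]|z]//; exact: normc_ge_Re.
have [s hs] : exists s : R^o, (fun t => complex.Im (h t) : R^o) @ F --> s.
  apply: part_lim => [[? ?] [? ?]|z]//.
  by rewrite normc_def lecR -sqrtr_sqr ler_wsqrtr // lerDr sqr_ge0.
exists (r +i* s)%C; apply/cvgrPdist_lt => e e0.
have eE : e = (complex.Re e)%:C by rewrite (RRe_real (gtr0_real e0)).
have e20 : 0 < complex.Re e / 2 by rewrite divr_gt0 // -ltcR -eE.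
move/cvgrPdist_lt/(_ _ e20): hr => hr; move/cvgrPdist_lt/(_ _ e20): hs => hs.
near=> t; apply: le_lt_trans (norm_complex_le _) _.
rewrite eE [complex.Re e]splitr rmorphD /=; apply: ltrD; rewrite ltcR.
- case E : (h t) => [u v] /=.
    rewrite (_ : u = complex.Re (h t)); last by rewrite E.
  by near: t.
- case E : (h t) => [u v] /=.
    rewrite (_ : v = complex.Im (h t)); last by rewrite E.
  by near: t.
Unshelve. all: by end_near. Qed.

Lemma cauchy_norm (V : normedModType R[i]) (F : set_system V) :
  ProperFilter F -> cauchy F ->
  forall e : R[i], 0 < e ->
    exists2 U, F U & forall x y, U x -> U y -> `|x - y| < e.
Proof.
move=> FF /cauchyP cF e e0; have e20 : 0 < e / 2 by rewrite divr_gt0.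
have [x Fx] := cF _ e20; exists (ball x (e / 2)) => // y z.
rewrite -ball_normE /= => xy xz; rewrite (_ : y - z = (x - z) - (x - y)).
  apply: le_lt_trans (ler_normB _ _) _.
  by rewrite [e in _ < e]splitr; exact: ltrD.
by rewrite opprB [RHS]addrC subrKA.
Qed.

Lemma closed_norm_mem (V : normedModType R[i]) (S : set V) (x : V) :
  closed S -> (forall e : R[i], 0 < e -> exists2 y, S y & `|x - y| < e) -> S x.
Proof.
move=> cS Sx; apply: cS => U /nbhs_ballP[e /= e0 eU].
have [y Sy xy] := Sx e e0; exists y; split => //; apply: eU.
by rewrite -ball_normE.
Qed.

End Completeness.

Lemma cvg0_norm_le (K : numFieldType) (V W : normedModType K) (T : Type)
    (F : set_system T) (f : T -> V) (g : T -> W) (c : K) : Filter F ->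
  0 <= c -> (forall t, `|g t| <= c * `|f t|) ->
  f @ F --> (0 : V) -> g @ F --> (0 : W).
Proof.
move=> FF c0 gf /cvgr0Pnorm_lt f0; apply/cvgr0Pnorm_lt => e e0.
have c1 : 0 < 1 + c by rewrite ltr_pwDl.
have ec0 : 0 < e / (1 + c) by rewrite divr_gt0.
apply: filterS (f0 _ ec0) => t ft; apply: le_lt_trans (gf t) _.
apply: (@le_lt_trans _ _ (c * (e / (1 + c)))).
  by rewrite ler_wpM2l // ltW.
by rewrite mulrCA gtr_pMr // ltr_pdivrMr // mul1r ltrDr.
Qed.

(** * Weak topologies *)

Section ContinuousFunctions.
Variables (R : realType) (T : topologicalType).
Implicit Types f g : T -> R[i]^o.

Lemma continuous_oppf f : continuous f -> continuous (fun x => - f x).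
Proof. by move=> cf x; exact: cvgN (cf x). Qed.

Lemma continuous_subf f g :
  continuous f -> continuous g -> continuous (fun x => f x - g x).
Proof. by move=> cf cg x; exact: cvgB (cf x) (cg x). Qed.

End ContinuousFunctions.

Section WeakTopology.
Variables (R : realType) (E I : choiceType) (p : E -> I -> R[i]^o).

Lemma sigma_cvg (F : set_system E) (x : E) : Filter F ->
  (forall i, (fun y => p y i) @ F --> p x i) -> F --> (x : sigma_top p).
Proof.
move=> FF Fp U [_ [[B oB <-] Bx] BU].
have pF : (p : E -> {ptws I -> R[i]^o}) @ F --> (p x : {ptws I -> R[i]^o}).
  apply/cvg_sup => i W [_ [[C oC <-] Ci] CW].
  have FC : F [set y | C (p y i)] by exact: Fp (open_nbhs_nbhs (conj oC Ci)).
  suff : F [set y | W (p y)] by [].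
  by apply: filterS FC => y; exact: CW.
have FB : F [set y | B (p y)] by exact: pF (open_nbhs_nbhs (conj oB Bx)).
by apply: filterS FB => y; exact: BU.
Qed.

(** The sets containing a subset cut out by finitely many equations
    [p y i = p x i] form a filter along which every [p^~ i] is eventually
    constant, so this filter converges to [x]. *)
Lemma sigma_nbhs_eqs (x : E) (U : set E) : nbhs (x : sigma_top p) U ->
  exists s : seq I, forall y, (forall i, i \in s -> p y i = p x i) -> U y.
Proof.
pose F : set_system E := [set W | exists s : seq I,
  forall y, (forall i, i \in s -> p y i = p x i) -> W y].
have FF : Filter F.
  split; first by exists [::].
  - move=> V W [s sV] [t tW]; exists (s ++ t) => y yst; split.
      by apply: sV => i si; apply: yst; rewrite mem_cat si.
    by apply: tW => i ti; apply: yst; rewrite mem_cat ti orbT.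
  - by move=> V W VW [s sV]; exists s => y /sV /VW.
have Fx : F --> (x : sigma_top p).
  apply: sigma_cvg => i; apply: cvg_near_cst.
  by exists [:: i] => y; apply; rewrite mem_head.
exact: Fx.
Qed.

End WeakTopology.

Section WeakFunctional.
Variables (R : realType) (X : normedModType R[i]).
Implicit Types f g : dual X.

Lemma dual0 f : f 0 = 0.
Proof. by rewrite -(scale0r 0) dualZ scale0r. Qed.

Lemma dualD f x y : f (x + y) = f x + f y.
Proof. by have := dual_linear f 1 x y; rewrite !scale1r. Qed.

Lemma dualB f x y : f (x - y) = f x - f y.
Proof. by rewrite dualD -scaleN1r dualZ scaleN1r. Qed.

(** By induction on the number of equations: if [g] does not vanish on the
    common kernel [K] of the remaining functionals, pick [u] in [K] with
    [g u = 1]; then [f - f u *: g] vanishes on [K]. *)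
Lemma common_kernel_span (S : set (dual X)) (s : seq (dual X)) f :
  S 0 -> (forall k g h, S g -> S h -> S (k *: g + h)) ->
  (forall g, g \in s -> S g) ->
  (forall x, (forall g, g \in s -> g x = 0) -> f x = 0) -> S f.
Proof.
move=> S0 Slin; elim: s f => [|g s IH] f sS fs.
  rewrite (_ : f = 0) //; apply/val_inj/funext => x.
  exact: fs.
have sS' h : h \in s -> S h by move=> hs; apply: sS; rewrite inE hs orbT.
have [gs|] := pselect (forall x, (forall h, h \in s -> h x = 0) -> g x = 0).
  apply: IH => // x xs; apply: fs => h; rewrite inE => /predU1P[->|];
    [exact: gs|exact: xs].
move/existsNP => [v /not_implyP[vs /eqP gv0]].
pose u := (g v)^-1 *: v.
have us h : h \in s -> h u = 0 by move=> hs; rewrite dualZ (vs _ hs) scaler0.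
have gu : g u = 1 by rewrite dualZ; exact: mulVf.
have -> : f = f u *: g + (- f u *: g + f).
  by rewrite addrA -scalerDl subrr scale0r add0r.
apply: Slin; first by apply: sS; rewrite mem_head.
apply: IH => // x xs; rewrite dual_linE.
have : f (x - g x *: u) = 0.
  apply: fs => h; rewrite inE => /predU1P[->|hs]; rewrite dualB dualZ.
    by rewrite gu [_ *: _]mulr1 subrr.
  by rewrite (xs _ hs) (us _ hs) scaler0 subrr.
rewrite dualB dualZ => /eqP; rewrite subr_eq0 => /eqP ->.
by rewrite scaleNr [f u *: _]mulrC addrC subrr.
Qed.

(** A functional continuous for the weak topology defined by [I] is bounded by
    1 on the common kernel of finitely many members of [I]; that kernel is a
    subspace, so the functional vanishes there. *)
Lemma sigma_continuous_mem (I : choiceType) (j : I -> dual X)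
    (S : set (dual X)) f :
  S 0 -> (forall k g h, S g -> S h -> S (k *: g + h)) ->
  (forall i, S (j i)) ->
  continuous (f : sigma_top (fun x i => j i x) -> R[i]^o) -> S f.
Proof.
move=> S0 Slin jS cf.
have : nbhs (0 : sigma_top (fun x i => j i x)) [set x | `|f 0 - f x| < 1].
  by have /cvgrPdist_lt/(_ _ ltr01) := cf (0 : X).
move=> /sigma_nbhs_eqs[s sf].
apply: (@common_kernel_span _ (map j s)) => // [_ /mapP[i _ ->]//|x xs].
have xker k i : i \in s -> j i (k *: x) = j i 0.
  by move=> si; rewrite dualZ xs ?map_f // scaler0 dual0.
apply/eqP; apply: contraT => fx0.
have := sf _ (xker (f x)^-1); rewrite /= dual0 sub0r normrN dualZ.
by rewrite [_ *: _]mulVf // normr1 ltxx.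
Qed.

End WeakFunctional.

(** * Closed submodules as bimodules *)

Lemma lactBl (R : realType) (A : banach_algebra R) (X : normedModType R[i])
    (B : bimodule A X) a b x : lact B (a - b) x = lact B a x - lact B b x.
Proof. by rewrite addrC -scaleN1r lact_linearl scaleN1r addrC. Qed.

Lemma commutatorB (R : realType) (A : banach_algebra R) (X : normedModType R[i])
    (B : bimodule A X) a x y :
  lact B a (x - y) - ract B (x - y) a =
  (lact B a x - ract B x a) - (lact B a y - ract B y a).
Proof.
rewrite [x - y]addrC -scaleN1r lact_linearr ract_linearl !scaleN1r.
by rewrite ![- _ y _ + _]addrC ![- _ _ y + _]addrC !opprD addrACA.
Qed.

Section ClosedSubmoduleTheory.
Variables (R : realType) (A : banach_algebra R).

Section Restriction.
Variables (X : normedModType R[i]) (B : bimodule A X) (S : closed_submodule B).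

Definition csub_lact_elt a (x : csub S) : csub S :=
  Csub (introT (asboolP _) (csub_lact a (csub_mem x))).

Definition csub_ract_elt (x : csub S) a : csub S :=
  Csub (introT (asboolP _) (csub_ract a (csub_mem x))).

Definition csub_bimodule : bimodule A (csub S).
Proof.
apply: (@Bimodule R A (csub S) csub_lact_elt csub_ract_elt).
- by move=> x k a b; apply/val_inj; exact: lact_linearl.
- by move=> a k x y; apply/val_inj; exact: lact_linearr.
- by move=> a k x y; apply/val_inj; exact: ract_linearl.
- by move=> x k a b; apply/val_inj; exact: ract_linearr.
- by move=> a b x; apply/val_inj; exact: lactM.
- by move=> x a b; apply/val_inj; exact: ractM.
- by move=> a x b; apply/val_inj; exact: lract.
- by have [M BM] := lact_bounded B; exists M => a x; exact: BM.
- by have [M BM] := ract_bounded B; exists M => x a; exact: BM.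
Defined.

End Restriction.

Lemma csub_cauchy_cvg (X : completeNormedModType R[i]) (B : bimodule A X)
    (S : closed_submodule B) (F : set_system (csub S)) :
  ProperFilter F -> cauchy F -> cvg F.
Proof.
move=> FF cF.
have /cvg_ex[l Fl] : cvg ((@csub_val R A X B S : csub S -> X) @ F).
  apply: cauchy_cvg; apply: cauchy_exP => e e0.
  have [U FU Ue] := cauchy_norm FF cF e0; have [x Ux] := filter_ex FU.
  exists (csub_val x).
  suff : F [set y | ball (csub_val x) e (csub_val y)] by [].
  by apply: filterS FU => y Uy; rewrite -ball_normE; exact: Ue.
have Sl : csub_set S l.
  apply: (@closed_norm_mem R X (csub_set S) l) => [|e e0].
    exact: csub_closed.
  move/cvgrPdist_lt/(_ _ e0): Fl => /filter_ex[x xe].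
  by exists (csub_val x) => //; exact: csub_mem.
apply/cvg_ex; exists (Csub (introT (asboolP _) Sl)).
apply/cvgrPdist_lt => e e0; move/cvgrPdist_lt/(_ _ e0): Fl.
exact: filterS.
Qed.

End ClosedSubmoduleTheory.

(** * Weak-star continuous functionals and completeness of [L2] *)

Section L2Complete.
Variables (R : realType) (A : banach_algebra R) (P : predual A).
Local Notation wstar := (wstar P).

Lemma wstar_continuous_mem (f : dual A) :
  continuous (f : wstar -> R[i]^o) -> csub_set (pre_sub P) f.
Proof.
apply: (@sigma_continuous_mem _ _ _ (fun phi => csub_val phi)) => [||phi].
- exact: csub0.
- exact: csub_linear.
- exact: csub_mem.
Qed.

Lemma mem_wstar_continuous (f : dual A) :
  csub_set (pre_sub P) f -> continuous (f : wstar -> R[i]^o).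
Proof.
move=> Sf; have Sf' := introT (asboolP _) Sf.
exact: (@wstar_continuous_pre _ _ P (Csub Sf')).
Qed.

(** The predual is norm closed, and its members are exactly the functionals
    that are continuous for the weak-star topology. *)
Lemma norm_lim_wstar_continuous (f : dual A) :
  (forall e : R[i], 0 < e ->
     exists2 g : dual A, csub_set (pre_sub P) g & `|f - g| < e) ->
  continuous (f : wstar -> R[i]^o).
Proof.
move=> fS; apply: mem_wstar_continuous.
by apply: closed_norm_mem fS; exact: csub_closed.
Qed.

(** The canonical map from [A] to the dual of the predual is isometric, hence
    injective. *)
Lemma predual_separates (a b : A) :
  (forall phi : csub (pre_sub P), csub_val phi a = csub_val phi b) -> a = b.
Proof.
move=> ab; apply/eqP; rewrite -subr_eq0 -normr_eq0 -(pre_isometry P) normr_eq0.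
apply/eqP/val_inj/funext => phi; change (csub_val phi (a - b) = 0).
by rewrite dualB ab subrr.
Qed.

Lemma L2_left_subproof (F : L2 P) (b : A) :
  (fun a => F a b) \in bounded_functional (X := A).
Proof.
have [lF _ _ _ _] := L2P F; apply/asboolP; split; first exact: lF.
exists (complex.Re `|F| * complex.Re `|b|) => a.
by rewrite rmorphM /= !ReK_norm mulrAC; exact: L2_norm_ub.
Qed.

Lemma L2_right_subproof (F : L2 P) (a : A) :
  F a \in bounded_functional (X := A).
Proof.
have [_ rF _ _ _] := L2P F; apply/asboolP; split; first exact: rF.
exists (complex.Re `|F| * complex.Re `|a|) => b.
by rewrite rmorphM /= !ReK_norm; exact: L2_norm_ub.
Qed.

Definition L2_left (F : L2 P) b : dual A := Dual (L2_left_subproof F b).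
Definition L2_right (F : L2 P) a : dual A := Dual (L2_right_subproof F a).

Lemma L2_left_mem F b : csub_set (pre_sub P) (L2_left F b).
Proof.
by apply: wstar_continuous_mem; have [_ _ _ cF _] := L2P F; exact: cF.
Qed.

Lemma L2_right_mem F a : csub_set (pre_sub P) (L2_right F a).
Proof.
by apply: wstar_continuous_mem; have [_ _ _ _ cF] := L2P F; exact: cF.
Qed.

(** The pointwise limit is bilinear and bounded, and its partial functionals are
    norm limits of partial functionals that lie in the predual; this preserves
    the separate weak-star continuity. *)
Lemma L2_cauchy_cvg (F : set_system (L2 P)) :
  ProperFilter F -> cauchy F -> cvg F.
Proof.
move=> FF cF.
have ev_lim a b : exists z : R[i]^o, (fun f : L2 P => f a b) @ F --> z.
  apply: complex_cauchy_lim => e e0; pose d : R[i] := 1 + `|a| * `|b|.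
  have d0 : 0 < d by rewrite ltr_pwDl // mulr_ge0.
  have ed0 : 0 < e%:C / d by rewrite divr_gt0 // ltcR.
  have [U FU Ue] := cauchy_norm FF cF ed0; exists U => // f g Uf Ug.
  apply: (@le_lt_trans _ _ (`|f - g| * (`|a| * `|b|))).
    by rewrite mulrA; exact: (L2_norm_ub (f - g) a b).
  apply: (@le_lt_trans _ _ (e%:C / d * (`|a| * `|b|))).
    by apply: ler_wpM2r; rewrite ?mulr_ge0 // ltW // Ue.
  by rewrite -mulrA gtr_pMr ?ltcR // ltr_pdivrMl // mulr1 ltrDr.
pose G a b : R[i]^o := sval (cid (ev_lim a b)).
have GE a b : (fun f : L2 P => f a b) @ F --> G a b.
  exact: (svalP (cid (ev_lim a b))).
have G_linl b : linear (G^~ b).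
  move=> k x y; apply: (cvg_unique _ (GE _ b)); first exact: norm_hausdorff.
  have -> : (fun f : L2 P => f (k *: x + y) b) = (fun f => k *: f x b + f y b).
    by apply/funext => f; have [-> _ _ _ _] := L2P f.
  have := cvgD (cvgZl_tmp (k := k) (GE x b)) (GE y b); exact.
have G_linr a : linear (G a).
  move=> k x y; apply: (cvg_unique _ (GE a _)); first exact: norm_hausdorff.
  have -> : (fun f : L2 P => f a (k *: x + y)) = (fun f => k *: f a x + f a y).
    by apply/funext => f; have [_ -> _ _ _] := L2P f.
  have := cvgD (cvgZl_tmp (k := k) (GE a x)) (GE a y); exact.
(* The pointwise limit is attained uniformly on bounded sets. Allowing twice
   the oscillation avoids passing to the limit in an inequality. *)
have G_unif (e : R[i]) : 0 < e -> exists2 U, F U & forall f, U f ->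
    forall a b, `|f a b - G a b| <= e * `|a| * `|b|.
  move=> e0; have e20 : 0 < e / 2 by rewrite divr_gt0.
  have [U FU Ue] := cauchy_norm FF cF e20; exists U => // f Uf a b.
  have [a0|a0] := eqVneq a 0.
    have -> : G a b = 0.
      by have := G_linl b (-1) 0 0; rewrite a0 scaler0 addr0 scaleN1r addNr.
    by rewrite a0 -(scale0r (0 : A)) L2Zl !scale0r subr0 !normr0 mulr0 mul0r.
  have [b0|b0] := eqVneq b 0.
    have -> : G a b = 0.
      by have := G_linr a (-1) 0 0; rewrite b0 scaler0 addr0 scaleN1r addNr.
    by rewrite b0 -(scale0r (0 : A)) L2Zr !scale0r subr0 !normr0 mulr0.
  have eab : 0 < e / 2 * (`|a| * `|b|)
    by apply: mulr_gt0 => //; rewrite mulr_gt0 ?normr_gt0.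
  move/cvgrPdist_lt/(_ _ eab): (GE a b) => GU.
  have [g [Ug gG]] := filter_ex (filterI FU GU).
  rewrite -[f a b](subrK (g a b)) -addrA; apply: le_trans (ler_normD _ _) _.
  rewrite -mulrA [e in leRHS]splitr mulrDl; apply: lerD; last first.
    by rewrite distrC ltW.
  apply: le_trans (L2_norm_ub (f - g) a b) _; rewrite -mulrA.
  by apply: ler_wpM2r; rewrite ?mulr_ge0 // ltW // Ue.
have [U1 FU1 U1G] := G_unif 1 ltr01; have [f1 Uf1] := filter_ex FU1.
have G_bd a b : `|G a b| <= (`|f1| + 1) * `|a| * `|b|.
  rewrite -[G a b](subrK (f1 a b)) addrC mulrDl mulrDl.
  apply: le_trans (ler_normD _ _) _; apply: lerD; first exact: L2_norm_ub.
  by rewrite distrC; exact: U1G.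
have nE : `|f1| + 1 = (complex.Re (`|f1| + 1))%:C.
  by rewrite RRe_real // ger0_real // addr_ge0.
have Gl b : (G^~ b) \in bounded_functional (X := A).
  apply/asboolP; split; first exact: G_linl.
  exists (complex.Re (`|f1| + 1) * complex.Re `|b|) => a.
  by rewrite rmorphM /= -nE ReK_norm mulrAC.
have Gr a : G a \in bounded_functional (X := A).
  apply/asboolP; split; first exact: G_linr.
  exists (complex.Re (`|f1| + 1) * complex.Re `|a|) => b.
  by rewrite rmorphM /= -nE ReK_norm.
have GL : G \in in_L2 P.
  apply/asboolP; split; [exact: G_linl|exact: G_linr| | |].
  - by exists (complex.Re (`|f1| + 1)) => a b; rewrite -nE.
  - move=> b; apply: (@norm_lim_wstar_continuous (Dual (Gl b))) => e e0.
    have ed0 : 0 < e / (1 + `|b|) by rewrite divr_gt0 // ltr_pwDl.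
    have [U FU UG] := G_unif _ ed0; have [f Uf] := filter_ex FU.
    exists (L2_left f b); first exact: L2_left_mem.
    apply: (@le_lt_trans _ _ (e / (1 + `|b|) * `|b|)).
      apply: dual_norm_le => [|a]; first by rewrite mulr_ge0 // ltW.
      by rewrite distrC mulrAC; exact: UG.
    by rewrite -mulrA gtr_pMr // ltr_pdivrMl ?ltr_pwDl // mulr1 ltrDr.
  - move=> a; apply: (@norm_lim_wstar_continuous (Dual (Gr a))) => e e0.
    have ed0 : 0 < e / (1 + `|a|) by rewrite divr_gt0 // ltr_pwDl.
    have [U FU UG] := G_unif _ ed0; have [f Uf] := filter_ex FU.
    exists (L2_right f a); first exact: L2_right_mem.
    apply: (@le_lt_trans _ _ (e / (1 + `|a|) * `|a|)).
      apply: dual_norm_le => [|b]; first by rewrite mulr_ge0 // ltW.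
      by rewrite distrC; exact: UG.
    by rewrite -mulrA gtr_pMr // ltr_pdivrMl ?ltr_pwDl // mulr1 ltrDr.
apply/cvg_ex; exists (MkL2 GL); apply/cvgrPdist_lt => e e0.
have e20 : 0 < e / 2 by rewrite divr_gt0.
have [U FU UG] := G_unif _ e20; apply: filterS FU => f Uf.
apply: (@le_lt_trans _ _ (e / 2)); last first.
  by rewrite ltr_pdivrMr // ltr_pMr // ltr1n.
apply: L2_norm_le => [|a b]; first exact: ltW.
by change (`|G a b - f a b| <= e / 2 * `|a| * `|b|); rewrite distrC; exact: UG.
Qed.

End L2Complete.

(** * From an approximate diagonal to approximate innerness *)

Section DerivationForm.
Variables (R : realType) (A : banach_algebra R) (P : predual A).
Variables (X : normedModType R[i]) (B : bimodule A X) (D : A -> dual X).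
Hypotheses (derD : is_derivation (dual_bimodule B) D)
  (cD : continuous (D : wstar P -> dual_wstar X))
  (nD : forall a, normal_elt P B (D a)).

Lemma derivation_form_bound : exists2 c : R[i], 0 <= c &
  forall x a b, `|D b (ract B x a)| <= c * `|x| * `|a| * `|b|.
Proof.
have [_ [M DM] _] := derD; have [N BN] := ract_bounded B.
exists (`|M|%:C * `|N|%:C) => [|x a b]; first by rewrite mulr_ge0 // lecR.
have lerC (r : R) (z : R[i]) : 0 <= z -> r%:C * z <= `|r|%:C * z.
  by move=> z0; apply: ler_wpM2r => //; rewrite lecR ler_norm.
have -> : `|M|%:C * `|N|%:C * `|x| * `|a| * `|b| =
    (`|M|%:C * `|b|) * (`|N|%:C * (`|x| * `|a|)).
  by rewrite mulrACA [`|b| * _]mulrC !mulrA.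
apply: le_trans (dual_norm_ub (D b) _) _; apply: ler_pM => //.
  exact: le_trans (DM b) (lerC _ _ _).
apply: le_trans (BN x a) _; rewrite -mulrA; apply: lerC.
exact: mulr_ge0.
Qed.

Lemma derivation_form_subproof (x : X) :
  (fun a b => D b (ract B x a)) \in in_L2 P.
Proof.
have [linD _ _] := derD; apply/asboolP; split.
- by move=> b k a a'; rewrite ract_linearr dual_linear.
- by move=> a k b b'; rewrite linD dual_linE.
- have [c c0 Dc] := derivation_form_bound.
  exists (complex.Re (c * `|x|)) => a b.
  by rewrite (RRe_real (ger0_real _)) ?mulr_ge0.
- move=> b a.
  exact: (continuous_comp ((nD b).1 a)
    (@sigma_pairing_continuous R _ _ (fun (f : dual X) (y : X) => f y) x _)).
- move=> a b.
  have ev := @sigma_pairing_continuous R _ _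
    (fun (f : dual X) (y : X) => f y) (ract B x a).
  exact: (@continuous_comp (wstar P) (dual_wstar X) R[i]^o D
    (fun f : dual_wstar X => (f : dual X) (ract B x a)) b (@cD b) (ev (D b))).
Qed.

(** This is [(a, b) |-> <a.D(b), x>], the dual left action on [D b] being moved
    to [x]. It is weak-star continuous in [a] since [D b] is normal, and in [b]
    since [D] is continuous. *)
Definition derivation_form (x : X) : L2 P := MkL2 (derivation_form_subproof x).

Lemma transport_subproof (M : dual (L2 P)) :
  (fun x => M (derivation_form x)) \in bounded_functional (X := X).
Proof.
apply/asboolP; split=> [k x y|].
  rewrite -dual_linear; congr (M _).
  apply/val_inj/funext => a; apply/funext => b.
  by rewrite /= ract_linearl dual_linear.
have [c c0 Dc] := derivation_form_bound.
exists (complex.Re (`|M| * c)) => x.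
rewrite (RRe_real (ger0_real _)) ?mulr_ge0 //.
apply: le_trans (dual_norm_ub M _) _; rewrite -mulrA; apply: ler_wpM2l => //.
by apply: L2_norm_le => [|a b]; [rewrite mulr_ge0|exact: Dc].
Qed.

(** The adjoint of [x |-> derivation_form x]: it sends an approximate diagonal
    to a net that approximately implements [D]. *)
Definition transport (M : dual (L2 P)) : dual X := Dual (transport_subproof M).

Lemma transport_bound : exists2 c : R[i], 0 <= c &
  forall M, `|transport M| <= c * `|M|.
Proof.
have [c c0 Dc] := derivation_form_bound; exists c => // M.
apply: dual_norm_le => [|x]; first by rewrite mulr_ge0.
apply: le_trans (dual_norm_ub M _) _; rewrite mulrAC [leRHS]mulrC.
apply: ler_wpM2l => //.
by apply: L2_norm_le => [|a b]; [rewrite mulr_ge0|exact: Dc].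
Qed.

(** The derivation rule turns [<b.D(c), a.x>] into the difference of
    [<b.D(ca), x>] and [<bc.D(a), x>]. The latter is the functional
    [b |-> <b.D(a), x>] evaluated at the product [bc]; it lies in the predual
    since [D a] is normal, so [M] acts on it through [Delta M]. *)
Lemma transport_commutator (M : dual (L2 P)) (a : A) :
  lact (dual_bimodule B) a (transport M) -
  ract (dual_bimodule B) (transport M) a =
  transport (lact (dual_bimodule (L2_bimodule P)) a M -
             ract (dual_bimodule (L2_bimodule P)) M a) +
  lact (dual_bimodule B) (Delta M) (D a).
Proof.
have [_ _ D_mul] := derD.
apply/val_inj/funext => x.
pose psi : csub (pre_sub P) :=
  Csub (introT (asboolP _) (L2_left_mem (derivation_form x) a)).
have form_ract : derivation_form (ract B x a) =
    ract (L2_bimodule P) (derivation_form x) a.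
  by apply/val_inj/funext => b; apply/funext => c; rewrite /= ractM.
have form_lact : derivation_form (lact B a x) =
    lact (L2_bimodule P) a (derivation_form x) - Delta_pre psi.
  apply/val_inj/funext => b; apply/funext => c.
  change (D c (ract B (lact B a x) b) =
    D (c ** a) (ract B x b) - D a (ract B x (b ** c))).
  rewrite D_mul; change (D c (ract B (lact B a x) b) =
    D a (ract B (ract B x b) c) + D c (lact B a (ract B x b)) -
    D a (ract B x (b ** c))).
  by rewrite lract ractM addrAC subrr add0r.
change (M (derivation_form (ract B x a)) - M (derivation_form (lact B a x)) =
  (M (ract (L2_bimodule P) (derivation_form x) a) -
   M (lact (L2_bimodule P) a (derivation_form x))) + csub_val psi (Delta M)).
by rewrite form_ract form_lact dualB opprB addrA DeltaE addrAC.
Qed.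

End DerivationForm.

(** In [transport_commutator] the first summand tends to 0 because [transport]
    is bounded, and the second to [e.D(a)] because the dual action is bounded.
    The dual of a unital bimodule is unital, so [e.D(a) = D(a)]. *)
Lemma diagonal_inner (R : realType) (A : banach_algebra R) (P : predual A)
    (e : A) :
  has_approx_normal_virtual_diagonal P e -> approx_strongly_Connes_amenable P e.
Proof.
move=> [I [M [Mcomm MDelta]]] X B uB D derD cD nD.
exists I, (fun i => transport derD cD nD (M i)) => a.
have De : lact (dual_bimodule B) e (D a) = D a.
  by apply/val_inj/funext => x /=; rewrite (uB x).2.
rewrite -[X in _ --> X]add0r.
under eq_fun do rewrite transport_commutator.
apply: cvgD.
  have [c c0 Tc] := transport_bound derD cD nD.
  by apply: cvg0_norm_le c0 _ (Mcomm a) => i; exact: Tc.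
have [N BN] := lact_bounded (dual_bimodule B).
apply/subr_cvg0.
have c0 : 0 <= `|N|%:C * `|D a| by rewrite mulr_ge0 // lecR.
apply: (cvg0_norm_le (f := fun i => Delta (M i) - e) _ c0) => [i|]; last first.
  exact/subr_cvg0.
rewrite -{2}De -lactBl; apply: le_trans (BN _ _) _; rewrite mulrAC.
by do 2 apply: ler_wpM2r => //; rewrite lecR ler_norm.
Qed.

(** * From approximate innerness to an approximate diagonal *)

HB.instance Definition _ (R : realType) (A : banach_algebra R)
    (P : predual A) :=
  Uniform_isComplete.Build (L2 P) (@L2_cauchy_cvg R A P).

HB.instance Definition _ (R : realType) (A : banach_algebra R)
    (X : completeNormedModType R[i]) (B : bimodule A X)
    (S : closed_submodule B) :=
  Uniform_isComplete.Build (csub S) (@csub_cauchy_cvg R A X B S).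

Section ReducedBimodule.
Variables (R : realType) (A : banach_algebra R) (P : predual A).

(** Correcting [a.F] by an element of the range of [Delta_pre] does not change
    its class modulo that range; this correction is the one for which the result
    vanishes at [(b, e)]. *)
Definition reduced_lact (a : A) (F : L2 P) : L2 P :=
  L2_lact a F - Delta_pre (Csub (introT (asboolP _) (L2_left_mem F a))).

Lemma reduced_lactE a F b c :
  reduced_lact a F b c = F b (c ** a) - F (b ** c) a.
Proof. by []. Qed.

Lemma reduced_lact_bound a F : `|reduced_lact a F| <= 2 * `|a| * `|F|.
Proof.
have -> : 2 * `|a| * `|F| = `|F| * `|a| + `|F| * `|a|.
  by rewrite -mulrA mulr_natl mulr2n [`|a| * _]mulrC.
apply: L2_norm_le => [|b c]; first by rewrite addr_ge0 ?mulr_ge0.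
rewrite reduced_lactE; apply: le_trans (ler_normB _ _) _.
rewrite 2!mulrDl; apply: lerD; apply: le_trans (L2_norm_ub F _ _) _;
  rewrite -!mulrA; apply: (ler_wpM2l (normr_ge0 F)).
  rewrite [leRHS]mulrCA; apply: ler_wpM2l => //.
  by rewrite mulrC; exact: ba_normM.
by rewrite [leLHS]mulrC; apply: ler_wpM2l => //; exact: ba_normM.
Qed.

(** The correction terms of two successive left actions cancel, so that the
    corrected action is associative on all of [L2 P], not only modulo the range
    of [Delta_pre]. *)
Definition reduced_bimodule : bimodule A (L2 P).
Proof.
apply: (@Bimodule R A (L2 P) reduced_lact (@L2_ract R A P)).
- move=> F k a b; apply/val_inj/funext => x; apply/funext => y.
  have [_ rF _ _ _] := L2P F.
  change (F x (y ** (k *: a + b)) - F (x ** y) (k *: a + b) =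
    k *: (F x (y ** a) - F (x ** y) a) + (F x (y ** b) - F (x ** y) b)).
  by rewrite ba_mul_linearr !rF scalerBr opprD addrACA.
- move=> a k F G; apply/val_inj/funext => x; apply/funext => y.
  change (k *: F x (y ** a) + G x (y ** a) -
      (k *: F (x ** y) a + G (x ** y) a) =
    k *: (F x (y ** a) - F (x ** y) a) + (G x (y ** a) - G (x ** y) a)).
  by rewrite scalerBr opprD addrACA.
- exact: (ract_linearl (L2_bimodule P)).
- exact: (ract_linearr (L2_bimodule P)).
- move=> a b F; apply/val_inj/funext => x; apply/funext => y.
  change (F x (y ** (a ** b)) - F (x ** y) (a ** b) =
    F x (y ** a ** b) - F (x ** (y ** a)) b -
    (F (x ** y) (a ** b) - F (x ** y ** a) b)).
  by rewrite !ba_mulA opprB addrA addrNK.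
- exact: (ractM (L2_bimodule P)).
- move=> a F b; apply/val_inj/funext => x; apply/funext => y.
  change (F (b ** x) (y ** a) - F (b ** x ** y) a =
    F (b ** x) (y ** a) - F (b ** (x ** y)) a).
  by rewrite ba_mulA.
- by exists 2 => a F; rewrite rmorphMn; exact: reduced_lact_bound.
- exact: (ract_bounded (L2_bimodule P)).
Defined.

Variables (e : A) (he : is_identity e).

(** A complement of the range of [Delta_pre]: subtract from [F] the image of its
    partial functional [F(., e)]. *)
Definition reduced_set : set (L2 P) := [set F | forall b, F b e = 0].

Lemma reduced_set_closed : closed reduced_set.
Proof.
move=> F clF b; apply/eqP; apply: contraT => Fb0.
have c0 : 0 < 1 + `|b| * `|e| by rewrite ltr_pwDl // mulr_ge0.
have r0 : 0 < `|F b e| / (1 + `|b| * `|e|) by rewrite divr_gt0 // normr_gt0.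
have [G [G0]] := clF _ (nbhsx_ballx F _ r0).
rewrite -ball_normE /= ltr_pdivlMr // => FG.
suff : `|F b e| < `|F b e| by rewrite ltxx.
apply: le_lt_trans FG.
have -> : F b e = (F - G) b e.
  by change (F b e = F b e - G b e); rewrite G0 subr0.
apply: le_trans (L2_norm_ub (F - G) b e) _.
by rewrite -mulrA; apply: (ler_wpM2l (normr_ge0 (F - G))); rewrite lerDr.
Qed.

Lemma reduced_lact_mem a F : reduced_set (reduced_lact a F).
Proof. by move=> b; rewrite reduced_lactE (he a).1 (he b).2 subrr. Qed.

Definition reduced_submodule : closed_submodule reduced_bimodule.
Proof.
apply: (@ClosedSubmodule R A (L2 P) reduced_bimodule reduced_set) => //.
- move=> k F G F0 G0 b; change (k *: F b e + G b e = 0).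
  by rewrite F0 G0 scaler0 addr0.
- by move=> a F _; exact: reduced_lact_mem.
- by move=> F a F0 b; exact: F0.
- exact: reduced_set_closed.
Defined.

Local Notation X := (csub reduced_submodule).
Local Notation BX := (csub_bimodule reduced_submodule).

Lemma reduced_unital : unital_bimodule e BX.
Proof.
move=> F; split; apply/val_inj/val_inj/funext => b; apply/funext => c.
  change (csub_val F b (c ** e) - csub_val F (b ** c) e = csub_val F b c).
  by rewrite (he c).2 (csub_mem F) subr0.
by change (csub_val F (e ** b) c = csub_val F b c); rewrite (he b).1.
Qed.

(** The projection along the range of [Delta_pre], a bimodule map from [L2 P]
    with its usual actions to the complement with the corrected ones. *)
Definition reduce (F : L2 P) : X :=
  Csub (introT (asboolP _) (reduced_lact_mem e F)
    : reduced_lact e F \in csub_pred reduced_submodule).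

Lemma reduceE F b c : csub_val (reduce F) b c = F b c - F (b ** c) e.
Proof. by rewrite reduced_lactE (he c).2. Qed.

Lemma reduce_Delta_pre phi : reduce (Delta_pre phi) = 0.
Proof.
apply/val_inj/val_inj/funext => b; apply/funext => c.
rewrite [LHS]reduceE.
change (csub_val phi (b ** c) - csub_val phi (b ** c ** e) = 0).
by rewrite (he _).2 subrr.
Qed.

Lemma reduce_lact a F : reduce (L2_lact a F) = lact BX a (reduce F).
Proof.
apply/val_inj/val_inj/funext => b; apply/funext => c.
rewrite [LHS]reduceE.
change (F b (c ** a) - F (b ** c) (e ** a) =
  csub_val (reduce F) b (c ** a) - csub_val (reduce F) (b ** c) a).
by rewrite !reduceE (he a).1 !ba_mulA opprB addrA addrNK.
Qed.

Lemma reduce_ract a F : reduce (L2_ract F a) = ract BX (reduce F) a.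
Proof.
apply/val_inj/val_inj/funext => b; apply/funext => c.
rewrite [LHS]reduceE.
change (F (a ** b) c - F (a ** (b ** c)) e = csub_val (reduce F) (a ** b) c).
by rewrite reduceE ba_mulA.
Qed.

Lemma pullback_subproof (y : dual X) :
  (fun F => y (reduce F)) \in bounded_functional (X := L2 P).
Proof.
apply/asboolP; split=> [k F G|].
  rewrite -dual_linear; congr (y _); apply/val_inj.
  exact: (lact_linearr reduced_bimodule).
exists (complex.Re (`|y| * (2 * `|e|))) => F.
rewrite (RRe_real (ger0_real _)) ?mulr_ge0 // -mulrA.
apply: le_trans (dual_norm_ub y _) _; apply: ler_wpM2l => //.
exact: reduced_lact_bound.
Qed.

Definition pullback (y : dual X) : dual (L2 P) := Dual (pullback_subproof y).

Lemma unit_tensor_subproof :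
  (fun F : L2 P => F e e) \in bounded_functional (X := L2 P).
Proof.
apply/asboolP; split=> [k F G|]; first exact: L2_linE.
exists (complex.Re (`|e| * `|e|)) => F.
rewrite (RRe_real (ger0_real _)) ?mulr_ge0 // mulrC mulrA.
exact: L2_norm_ub.
Qed.

(** The elementary tensor of [e] with itself, acting on bilinear functionals. *)
Definition unit_tensor : dual (L2 P) := Dual unit_tensor_subproof.

Lemma unit_derivation_subproof (a : A) :
  (fun F : X => - csub_val F e a) \in bounded_functional (X := X).
Proof.
apply/asboolP; split=> [k F G|].
  by rewrite csub_linE L2_linE opprD scalerN.
exists (complex.Re (`|e| * `|a|)) => F.
rewrite (RRe_real (ger0_real _)) ?mulr_ge0 // normrN [leRHS]mulrC mulrA.
exact: L2_norm_ub.
Qed.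

(** The inner derivation [a |-> a.u - u.a] of [u = unit_tensor] sends [F] to
    [F(a, e) - F(e, a)], and the first term vanishes on the complement. *)
Definition unit_derivation (a : A) : dual X :=
  Dual (unit_derivation_subproof a).

Lemma unit_derivationP : is_derivation (dual_bimodule BX) unit_derivation.
Proof.
split.
- move=> k a b; apply/val_inj/funext => F.
  change (- csub_val F e (k *: a + b) = k *: - csub_val F e a - csub_val F e b).
  by have [_ -> _ _ _] := L2P (csub_val F); rewrite opprD scalerN.
- exists (complex.Re `|e|) => a; rewrite ReK_norm.
  apply: dual_norm_le => [|F]; first by rewrite mulr_ge0.
  change (`|- csub_val F e a| <= `|e| * `|a| * `|csub_val F|).
  rewrite normrN [leRHS]mulrC mulrA; exact: L2_norm_ub.
- move=> a b; apply/val_inj/funext => F.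
  change (- csub_val F e (a ** b) = - csub_val F (a ** e) b -
    (csub_val F e (a ** b) - csub_val F (e ** a) b)).
  by rewrite (he a).1 (he a).2 opprB addrA addNr add0r.
Qed.

Lemma unit_derivation_continuous :
  continuous (unit_derivation : wstar P -> dual_wstar X).
Proof.
apply: sigma_continuous => F; have [_ _ _ _ cF] := L2P (csub_val F).
exact: continuous_oppf (cF e).
Qed.

Lemma unit_derivation_normal a : normal_elt P BX (unit_derivation a).
Proof.
split; apply: sigma_continuous => F.
  have -> : (fun c => lact (dual_bimodule BX) c (unit_derivation a) F) =
      (fun c => - csub_val F c a).
    apply/funext => c; change (- csub_val F (c ** e) a = - csub_val F c a).
    by rewrite (he c).2.
  have [_ _ _ cF _] := L2P (csub_val F); exact: continuous_oppf (cF a).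
have -> : (fun c => ract (dual_bimodule BX) (unit_derivation a) c F) =
    (fun c => csub_val F a c - csub_val F e (a ** c)).
  apply/funext => c.
  change (- (csub_val F e (a ** c) - csub_val F (e ** a) c) =
    csub_val F a c - csub_val F e (a ** c)).
  by rewrite (he a).1 opprB.
have [_ _ _ _ cF] := L2P (csub_val F).
apply: continuous_subf (cF a) _ => c.
exact: (continuous_comp (@wstar_continuous_mull R A P a c) (cF e (a ** c))).
Qed.

Lemma unit_tensor_commutator a :
  lact (dual_bimodule (L2_bimodule P)) a unit_tensor -
  ract (dual_bimodule (L2_bimodule P)) unit_tensor a =
  pullback (unit_derivation a).
Proof.
apply/val_inj/funext => F.
change (F (a ** e) e - F e (e ** a) = - csub_val (reduce F) e a).
by rewrite reduceE (he a).1 (he a).2 opprB.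
Qed.

Lemma pullback_commutator a y :
  lact (dual_bimodule (L2_bimodule P)) a (pullback y) -
  ract (dual_bimodule (L2_bimodule P)) (pullback y) a =
  pullback (lact (dual_bimodule BX) a y - ract (dual_bimodule BX) y a).
Proof.
apply/val_inj/funext => F.
change (y (reduce (L2_ract F a)) - y (reduce (L2_lact a F)) =
  y (ract BX (reduce F) a) - y (lact BX a (reduce F))).
by rewrite reduce_lact reduce_ract.
Qed.

Lemma pullbackB u v : pullback u - pullback v = pullback (u - v).
Proof. by apply/val_inj/funext. Qed.

Lemma pullback_bound y : `|pullback y| <= 2 * `|e| * `|y|.
Proof.
apply: dual_norm_le => [|F]; first by rewrite !mulr_ge0.
apply: le_trans (dual_norm_ub y _) _; rewrite mulrAC [leRHS]mulrC.
by apply: ler_wpM2l => //; exact: reduced_lact_bound.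
Qed.

(** A pullback vanishes on the range of [Delta_pre], so that it lies in the
    kernel of [Delta]. *)
Lemma Delta_unit_tensor_sub y : Delta (unit_tensor - pullback y) = e.
Proof.
apply: (predual_separates (P := P)) => phi; rewrite DeltaE.
change (csub_val phi (e ** e) - y (reduce (Delta_pre phi)) = csub_val phi e).
by rewrite reduce_Delta_pre dual0 subr0 (he e).1.
Qed.

(** The inner derivation of [unit_tensor] takes values in pullbacks; subtracting
    from [unit_tensor] pullbacks that approximately implement it makes the
    commutators small. *)
Lemma Connes_amenable_diagonal :
  approx_strongly_Connes_amenable P e -> has_approx_normal_virtual_diagonal P e.
Proof.
move=> amenA.
have [I [y yD]] := amenA _ BX reduced_unital _ unit_derivationP
  unit_derivation_continuous unit_derivation_normal.
exists I, (fun i => unit_tensor - pullback (y i)); split=> [a|]; last first.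
  by under eq_fun do rewrite Delta_unit_tensor_sub; exact: cvg_cst.
pose r i := unit_derivation a -
  (lact (dual_bimodule BX) a (y i) - ract (dual_bimodule BX) (y i) a).
have r0 : r i @[i --> tails I] --> (0 : dual X).
  rewrite -(subrr (unit_derivation a)); apply: cvgB (yD a); exact: cvg_cst.
have c0 : 0 <= 2 * `|e| by rewrite mulr_ge0.
apply: cvg0_norm_le c0 _ r0 => i.
rewrite commutatorB unit_tensor_commutator pullback_commutator pullbackB.
exact: pullback_bound.
Qed.

End ReducedBimodule.

Theorem theorem3p2 (R : realType) (A : banach_algebra R) (P : predual A)
    (e : A) (he : is_identity e) :
  has_approx_normal_virtual_diagonal P e <->
  approx_strongly_Connes_amenable P e.
Proof.
split; first exact: diagonal_inner.
exact: Connes_amenable_diagonal.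
Qed.
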